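(* Let $x_1,\dots,x_n$ be realized initial data samples, drawn IID from a distribution on $\mathbb{R}$ with CDF $F$. Let (realized, fixed) $LB<\theta$ partition the domain into three regions, with $\beta=F(LB)$ and $\alpha=F(\theta)$, and with $l$ and $m$ of the initial $n$ samples located below $LB$ and below $\theta$, respectively. Assume an additional $k_e$ samples between $LB$ and $\theta$ have been collected under an exploration probability $\epsilon$, and an additional $k_d$ samples above $\theta$ have been collected. Let $F_{n+k_e+k_d}$ denote the empirical CDF estimated from these $n+k_e+k_d$ non-IID samples, as defined in the context. Then, for every $\eta,k_e,k_d>0$, $$\mathbb{P}\Big[\sup_{x\in\mathbb{R}}|F(x)-F_{n+k_e+k_d}(x)|\ge\eta\Big]\le 2\exp\left(\frac{-2l\left(\eta-\left|\beta-\frac ln\right|\right)^2}{\min\left(\beta,\frac ln\right)^2}\right)$$ $$+2\exp\left(\frac{-2(m-l+k_e)\left(\eta-\left|\beta-\frac ln\right|-\left|\alpha-\beta-\frac{n-l}{n}\frac{m-l+k_e}{n-l+k_e+\epsilon k_d}\right|\right)^2}{\min\left(\alpha-\beta,\frac{n-l}{n}\frac{m-l+k_e}{n-l+k_e+\epsilon k_d}\right)^2}\right)$$ $$+2\exp\left(\frac{-2(n-m+k_d)\left(\eta-2\left|\alpha-\frac ln-\frac{n-l}{n}\frac{m-l+k_e}{n-l+k_e+\epsilon k_d}\right|\right)^2}{\min\left(1-\alpha,\frac{n-l}{n}\frac{n-m+\epsilon k_d}{n-l+k_e+\epsilon k_d}\right)^2}\right).$$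
   Context: Censored feedback with exploration: after the initial $n$ IID samples, new samples are drawn from the same distribution $F$; those above $\theta$ (disclosed region) are all collected, those in $(LB,\theta)$ (exploration region) are collected with probability $\epsilon$, and those below $LB$ (censored region) are not collected. For fixed $l,m,k_e,k_d$: the $l$ samples below $LB$ are IID with CDF $G(x)=F(x)/\beta$ ($x\le LB$); the $m-l+k_e$ samples between $LB$ and $\theta$ are IID with CDF $E(x)=(F(x)-\beta)/(\alpha-\beta)$ ($LB<x\le\theta$); the $n-m+k_d$ samples above $\theta$ are IID with CDF $K(x)=(F(x)-\alpha)/(1-\alpha)$ ($x>\theta$). Let $G_l$, $E_{m-l+k_e}$, $K_{n-m+k_d}$ be the corresponding ordinary empirical CDFs. Write $r=\frac{m-l+k_e}{n-l+k_e+\epsilon k_d}$, so that $1-r=\frac{n-m+\epsilon k_d}{n-l+k_e+\epsilon k_d}$. The estimate of $F(LB)$ is $\frac ln$, and the initial estimate $\frac mn$ of $F(\theta)$ is updated to $\frac ln+\frac{n-l}{n}r$. The full-domain empirical CDF is $$F_{n+k_e+k_d}(x)=\begin{cases}\frac ln G_l(x), & x\le LB,\\ \frac ln+\frac{n-l}{n}\,r\,E_{m-l+k_e}(x), & LB<x\le\theta,\\ \frac ln+\frac{n-l}{n}r+\frac{n-l}{n}(1-r)K_{n-m+k_d}(x), & x>\theta.\end{cases}$$ The probability is over the sample values in each region, with $LB,\theta,n,l,m,k_e,k_d,\epsilon$ fixed; the parameters are understood to be such that all expressions are defined.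
   Formalization: The bound is stated only for η at least each subtracted shift: |β−l/n|, |β−l/n|+|α−β−((n−l)/n)r|, and 2|α−l/n−((n−l)/n)r|; for arbitrary η>0 the printed inequality is false, since a negative margin is squared. *)

(* Defs.v *)
From HB Require Import structures.
From mathcomp Require Import all_boot all_order all_algebra.
From mathcomp Require Import all_classical all_reals all_analysis.

Set Implicit Arguments.
Unset Strict Implicit.
Unset Printing Implicit Defensive.

Import Order.TTheory GRing.Theory Num.Theory.
Import numFieldNormedType.Exports.

Local Open Scope classical_set_scope.
Local Open Scope ring_scope.

Definition mutually_independent d (T : measurableType d) (R : realType)
    (P : probability T R) (k : nat) (X : 'I_k -> {RV P >-> R}) : Prop :=
  forall (J : {set 'I_k}) (A : 'I_k -> set R),
    (forall i, measurable (A i)) ->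
    P (\bigcap_(i in [set` J]) (X i @^-1` A i)) =
    (\prod_(i in J) P (X i @^-1` A i))%E.

Definition iid_with_cdf d (T : measurableType d) (R : realType)
    (P : probability T R) (k : nat) (X : 'I_k -> {RV P >-> R})
    (H : R -> R) : Prop :=
  mutually_independent X /\ forall i x, cdf (X i) x = (H x)%:E.

(* The conditional CDFs of F on ]-oo, a], ]a, b] and ]b, +oo[, extended from
   these regions to all of R by the constants 0 and 1. *)
Definition cdf_below (R : realType) (F : R -> R) (a x : R) : R :=
  if x <= a then F x / F a else 1.

Definition cdf_between (R : realType) (F : R -> R) (a b x : R) : R :=
  if x <= a then 0 else
  if x <= b then (F x - F a) / (F b - F a) else 1.

Definition cdf_above (R : realType) (F : R -> R) (b x : R) : R :=
  if x <= b then 0 else (F x - F b) / (1 - F b).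

Definition ecdf (R : realType) (k : nat) (s : 'I_k -> R) (x : R) : R :=
  #|[pred i | s i <= x]|%:R / k%:R.

(* Estimated fraction of the data above LB that lies below theta: each of the
   kd extra samples above theta is weighted by the exploration probability eps
   with which samples between LB and theta are collected. *)
Definition explore_ratio (R : realType) (n l m ke kd : nat) (eps : R) : R :=
  (m - l + ke)%N%:R / ((n - l + ke)%N%:R + eps * kd%:R).

Definition censored_ecdf (R : realType) (LB theta eps : R) (n l m ke kd : nat)
    (xb : 'I_l -> R) (xe : 'I_(m - l + ke) -> R) (xd : 'I_(n - m + kd) -> R)
    (x : R) : R :=
  let r := explore_ratio n l m ke kd eps in
  if x <= LB then l%:R / n%:R * ecdf xb x else
  if x <= theta then l%:R / n%:R + (n - l)%N%:R / n%:R * r * ecdf xe x else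
  l%:R / n%:R + (n - l)%N%:R / n%:R * r
    + (n - l)%N%:R / n%:R * (1 - r) * ecdf xd x.

(* Main.v *)
(**
On each of the three regions the error is at most a bias plus a weight times the
Kolmogorov distance between the conditional CDF of that region and its empirical
CDF, so the theorem is a union bound over three instances of the
Dvoretzky-Kiefer-Wolfowitz inequality with Massart's constant.

One-sided DKW at level e: fix finitely many thresholds x_j, let N_j count the
samples <= x_j, and let tau be the LARGEST j with N_j >= n (F(x_j) + e). Compare
the law of an IID sample from F with that of an IID sample from
(F + a delta_{-oo}) / (1 + a). The event tau = j only depends on the sample after
identifying all points <= x_j; on it, the likelihood ratio of the two laws is
F(x_j)^k (1 + a)^n / (F(x_j) + a)^k with k = N_j. Hence P(tau exists) is at most
the largest such ratio, and one value of a makes all of them <= exp(-2 n e^2):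
this is the inequality (x + e) ln (1 + a / x) >= ln (1 + a) + 2 e^2 for all x > 0,
proved by differentiating twice in e. Neither continuity of F nor a restriction
on e is needed. The other side is the same statement for the reversed chain, and
right continuity passes from rational thresholds to all of R.
*)
Require Import Defs.
From HB Require Import structures.
From mathcomp Require Import all_boot all_order all_algebra.
From mathcomp Require Import all_classical all_reals all_analysis.
From mathcomp Require Import measurable_realfun zify ring lra.

Set Implicit Arguments.
Unset Strict Implicit.
Unset Printing Implicit Defensive.

Import Order.TTheory GRing.Theory Num.Theory.
Import numFieldNormedType.Exports.

Local Open Scope classical_set_scope.
Local Open Scope ring_scope.

(** * The tilting inequality *)

(* The numerator of the second derivative in e of
   (x + e) ln (1 + tilt e / x) - ln (1 + tilt e) - 2 e^2, divided by 36 e. *)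
Definition tilt_curvature (R : realType) (e x : R) : R :=
  (324 - 108 * e + 36 * e ^+ 2 - 276 * e ^+ 3 - 12 * e ^+ 4 + 36 * e ^+ 5
   + 36 * e ^+ 6 - 36 * e ^+ 7) * x ^+ 2
  + (- 324 + 432 * e + 252 * e ^+ 2 + 612 * e ^+ 3 + 72 * e ^+ 4
     - 164 * e ^+ 5 - 32 * e ^+ 6 + 128 * e ^+ 7 + 48 * e ^+ 8) * x
  + (81 - 162 * e + 27 * e ^+ 2 + 24 * e ^+ 3 + 243 * e ^+ 4 + 206 * e ^+ 5
     - 83 * e ^+ 6 - 212 * e ^+ 7 - 108 * e ^+ 8 - 16 * e ^+ 9).

(** A quadratic in [x]. For [e >= 1/2] its three coefficients are nonnegative; for smaller [e] it
    dominates a quadratic with nonpositive discriminant. The tight case is [e = 0], where it equals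
    [81 (2 x - 1)^2], with a double root at [x = 1/2]. *)
Lemma tilt_curvature_ge0 (R : realType) (e x : R) :
  0 <= e <= 1 -> 0 <= x -> 0 <= tilt_curvature e x.
Proof.
move=> /andP[e0 e1] x0; rewrite /tilt_curvature.
set A := (X in X * x ^+ 2); set B := (X in _ + X * x); set C := (X in _ + X).
have pw k : e ^+ k.+1 <= e ^+ k by rewrite exprS ler_piMl// exprn_ge0.
have := (pw 1, pw 2, pw 3, pw 4, pw 5, pw 6, pw 7) =>
  -[[[[[[P1 P2] P3] P4] P5] P6] P7].
rewrite expr1 in P1; have P8 : 0 <= e ^+ 8 by exact: exprn_ge0.
have A0 : 0 <= A.
  have -> : A = (1 - e) * (324 + 216 * e + 252 * e ^+ 2 - 24 * e ^+ 3 - 36 * e ^+ 4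
    + 36 * e ^+ 6) by rewrite /A; ring.
  by apply: mulr_ge0; lra.
have [eh|eh] := lerP (1 / 2) e.
  have he k : 0 <= (e - 1 / 2) * e ^+ k by apply: mulr_ge0; [lra|exact: exprn_ge0].
  have := (he 0, he 1, he 2, he 3, he 4) => -[[[[h0 h1] h2] h3] h4].
  rewrite mulrBl -exprS in h0; rewrite mulrBl -exprS in h1.
  rewrite mulrBl -exprS in h2; rewrite mulrBl -exprS in h3.
  rewrite mulrBl -exprS in h4; rewrite expr0 expr1 in h0; rewrite expr1 in h1.
  have B0 : 0 <= B by rewrite /B; lra.
  have C0 : 0 <= C.
    have -> : C = (1 - e) * (81 - 81 * e - 54 * e ^+ 2 - 30 * e ^+ 3 + 213 * e ^+ 4
      + 419 * e ^+ 5 + 336 * e ^+ 6 + 124 * e ^+ 7 + 16 * e ^+ 8) by rewrite /C; ring.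
    apply: mulr_ge0; first lra.
    (* [lra] treats the powers of [e] as independent atoms; the squares supply tangent bounds for
       [e ^+ 4] in terms of [e ^+ 2] and for [e ^+ 2] in terms of [e]. *)
    have := sqr_ge0 (e ^+ 2 - 35 / 100); have := sqr_ge0 (e - 19 / 100).
    rewrite !sqrrB -exprM => ? ?.
    have := (exprn_ge0 6 e0, exprn_ge0 7 e0, exprn_ge0 8 e0) => -[[? ?] ?].
    lra.
  by apply: addr_ge0 => //; apply: addr_ge0; apply: mulr_ge0 => //; exact: sqr_ge0.
(* Low-degree minorants of [A], [B], [C], up to the factors 36, 36, 27. The discriminant of the
   resulting quadratic is a negative multiple of [3 a c - b^2], which vanishes at [e = 0]; hence the
   factor [e] below. *)
set a := 9 - 3 * e + e ^+ 2 - 8 * e ^+ 3.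
set b := - 9 + 12 * e + 7 * e ^+ 2 + 16 * e ^+ 3.
set c := 3 - 6 * e + e ^+ 2 + 9 * e ^+ 4.
have hk k : e ^+ k.+1 <= e ^+ k / 2.
  by rewrite exprSr; apply: ler_wpM2l; [exact: exprn_ge0|lra].
have := (hk 3, hk 4, hk 5, hk 6, hk 7, hk 8) => -[[[[[h3 h4] h5] h6] h7] h8].
have A1 : 36 * a <= A by rewrite /a /A; lra.
have B1 : 36 * b <= B by rewrite /b /B; lra.
have C1 : 27 * c <= C by rewrite /c /C; lra.
have a0 : 0 < a by rewrite /a; have := hk 1; have := hk 2; rewrite expr1; lra.
apply: (@le_trans _ _ (36 * a * x ^+ 2 + 36 * b * x + 27 * c)); last first.
  by apply: lerD => //; apply: lerD; apply: ler_wpM2r => //; exact: sqr_ge0.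
rewrite -(@pmulr_rge0 _ a)//.
have -> : a * (36 * a * x ^+ 2 + 36 * b * x + 27 * c) =
  9 * ((2 * a * x + b) ^+ 2 + (3 * a * c - b ^+ 2)) by ring.
apply: mulr_ge0 => //; apply: addr_ge0; first exact: sqr_ge0.
have -> : 3 * a * c - b ^+ 2 = e * (27 + 72 * e + 21 * e ^+ 2
    - 43 * e ^+ 3 - 329 * e ^+ 4 - 229 * e ^+ 5 - 216 * e ^+ 6).
  by rewrite /a /b /c; ring.
have e2 : 0 <= e ^+ 2 by exact: exprn_ge0.
have e3 : e ^+ 3 <= e / 4 by have := hk 1; have := hk 2; rewrite expr1; lra.
have e4 : e ^+ 4 <= e / 8 by lra.
have e5 : e ^+ 5 <= e / 16 by lra.
have e6 : e ^+ 6 <= e / 32 by lra.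
apply: mulr_ge0; first exact: e0.
move: eh e2 e3 e4 e5 e6; clear; lra.
Qed.

Lemma is_derive_ge0_le (R : realType) (f df : R -> R) (b : R) : 0 <= b ->
  (forall t, 0 <= t <= b -> is_derive t 1 f (df t)) ->
  (forall t, 0 <= t <= b -> 0 <= df t) -> f 0 <= f b.
Proof.
move=> b0 fdf df0.
have [|s|c] := @MVT_segment R f df 0 b b0.
- by move=> t; rewrite in_itv/= => /andP[t0 tb]; apply: fdf; rewrite !ltW.
- move: s; apply: derivable_within_continuous => t; rewrite in_itv/= => tb.
  by have [] := fdf t tb.
- by rewrite in_itv/= => cb fE; rewrite -subr_ge0 fE subr0 mulr_ge0// df0.
Qed.

Section derivation_rules.
Variables (R : realType) (t : R).
Implicit Types f g : R -> R.

Let mulR f g df dg : is_derive t 1 f df -> is_derive t 1 g dg ->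
  is_derive t 1 (fun s => f s * g s) (f t * dg + g t * df).
Proof. exact: is_deriveM. Qed.

Lemma is_derive_div f g df dg : g t != 0 ->
  is_derive t 1 f df -> is_derive t 1 g dg ->
  is_derive t 1 (fun s => f s / g s) ((df * g t - f t * dg) / g t ^+ 2).
Proof.
move=> g0 fd gd; apply: (is_derive_eq (mulR fd (is_deriveV g0 gd))).
by rewrite /GRing.scale/=; field.
Qed.

Lemma is_derive_ln_comp f df : 0 < f t ->
  is_derive t 1 f df -> is_derive t 1 (fun s => ln (f s)) (df / f t).
Proof.
move=> f0 fd; have lnd := is_derive1_ln f0.
have := @is_derive1_comp R (@ln R) f t _ _ lnd fd; by rewrite mulrC.
Qed.
End derivation_rules.

Section tilt.
Variable R : realType.
Implicit Types e x : R.

(* A rational approximation of the saddle point: the optimal value is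
   e / (1 - x - e) where x minimizes the Kullback-Leibler divergence of
   Bernoulli(x + e) from Bernoulli(x), and both are 2 e + 8/3 e^2 + O(e^3). *)
Definition tilt e : R := 2 * e * (3 + e) / (3 * (1 - e)).

Let tilt1 e : R := 2 * (3 - e) * (1 + e) / (3 * (1 - e) ^+ 2).

Let tilt2 e : R := 16 / (3 * (1 - e) ^+ 3).

Lemma is_derive_tilt e : e < 1 -> is_derive e 1 tilt (tilt1 e).
Proof.
move=> e1.
have e1' : 1 - e != 0 by rewrite subr_eq0 gt_eqF.
have d0 : 3 * (1 - e) != 0 by rewrite mulf_neq0.
apply: (is_derive_eq (@is_derive_div _ e (fun s => 2 * s * (3 + s))
  (fun s => 3 * (1 - s)) _ _ d0 _ _)).
by rewrite /tilt1 /GRing.scale/=; field.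
Qed.

Lemma is_derive_tilt1 e : e < 1 -> is_derive e 1 tilt1 (tilt2 e).
Proof.
move=> e1.
have e1' : 1 - e != 0 by rewrite subr_eq0 gt_eqF.
have d0 : 3 * (1 - e) ^+ 2 != 0 by rewrite mulf_neq0 ?expf_neq0.
apply: (is_derive_eq (@is_derive_div _ e (fun s => 2 * (3 - s) * (1 + s))
  (fun s => 3 * (1 - s) ^+ 2) _ _ d0 _ _)).
by rewrite /tilt2 /GRing.scale/=; field.
Qed.

Let h x e : R :=
  (x + e) * (ln (x + tilt e) - ln x) - ln (1 + tilt e) - 2 * e ^+ 2.

Let h1 x e : R := ln (x + tilt e) - ln x
  + tilt1 e * ((x + e) / (x + tilt e) - 1 / (1 + tilt e)) - 4 * e.

Let h2 x e : R := 36 * e * tilt_curvature e x /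
  ((3 * (1 - e)) * (3 * (1 - e) * x + 6 * e + 2 * e ^+ 2) * (3 + 3 * e + 2 * e ^+ 2)) ^+ 2.

Lemma tilt_ge0 e : 0 <= e < 1 -> 0 <= tilt e.
Proof.
by move=> /andP[e0 e1]; rewrite /tilt divr_ge0 ?mulr_ge0//; lra.
Qed.

Lemma is_derive_h x e : 0 < x -> 0 <= e < 1 -> is_derive e 1 (h x) (h1 x e).
Proof.
move=> x0 e01; have a0 := tilt_ge0 e01; have /andP[e0 e1] := e01.
have xa : 0 < x + tilt e by lra.
have a1 : 0 < 1 + tilt e by lra.
have ad := is_derive_tilt e1.
have lx := @is_derive_ln_comp _ e (fun s => x + tilt s) _ xa _.
have l1 := @is_derive_ln_comp _ e (fun s => 1 + tilt s) _ a1 _.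
apply: is_derive_eq.
rewrite /h1 /GRing.scale/=.
by field; rewrite ?gt_eqF.
Qed.

Lemma is_derive_h1 x e : 0 < x -> 0 <= e < 1 -> is_derive e 1 (h1 x) (h2 x e).
Proof.
move=> x0 e01; have a0 := tilt_ge0 e01; have /andP[e0 e1] := e01.
have xa : 0 < x + tilt e by lra.
have a1 : 0 < 1 + tilt e by lra.
have ad := is_derive_tilt e1; have ad1 := is_derive_tilt1 e1.
have lx := @is_derive_ln_comp _ e (fun s => x + tilt s) _ xa _.
have n0 : x + tilt e != 0 by rewrite gt_eqF.
have n1 : 1 + tilt e != 0 by rewrite gt_eqF.
have dx := @is_derive_div _ e (fun s => x + s) (fun s => x + tilt s) _ _ n0 _ _.
have d1 := @is_derive_div _ e (fun s => 1) (fun s => 1 + tilt s) _ _ n1 _ _.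
apply: is_derive_eq.
rewrite /h2 /GRing.scale/= /tilt_curvature /tilt2 /tilt1 {dx d1 lx ad ad1}.
have m0 : 3 + 3 * e + 2 * e ^+ 2 != 0 by rewrite gt_eqF// ltr_wpDr ?mulr_ge0 ?sqr_ge0//; lra.
have s0 : 3 * (1 - e) * x + 6 * e + 2 * e ^+ 2 != 0.
  by rewrite gt_eqF// ltr_wpDr ?mulr_ge0 ?sqr_ge0// ltr_wpDr ?mulr_ge0 ?mulr_gt0 ?subr_gt0.
have e10 : 1 - e != 0 by rewrite gt_eqF ?subr_gt0.
by rewrite /tilt; field; rewrite m0 s0 e10.
Qed.

(** The difference [h x] of the two sides and its derivative [h1 x] both vanish at [e = 0], and the
    second derivative [h2 x] is nonnegative by [tilt_curvature_ge0]. *)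
Lemma tilt_le x e : 0 < x -> 0 <= e < 1 ->
  ln (1 + tilt e) + 2 * e ^+ 2 <= (x + e) * (ln (x + tilt e) - ln x).
Proof.
move=> x0 /andP[e0 e1].
have t0 : tilt 0 = 0 :> R by rewrite /tilt !(mulr0, mul0r).
rewrite -subr_ge0 opprD addrA.
have -> : 0 = h x 0 by rewrite /h t0 !addr0 ln1; ring.
apply: (@is_derive_ge0_le _ (h x) (h1 x)) => // [t /andP[tge0 te]|b /andP[b0 be]].
  by apply: is_derive_h; rewrite ?tge0 ?(le_lt_trans te).
have -> : 0 = h1 x 0 by rewrite /h1 t0 !addr0 divff ?gt_eqF// divr1; ring.
apply: (@is_derive_ge0_le _ (h1 x) (h2 x)) => // [t /andP[tge0 tb]|t /andP[tge0 tb]].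
  by apply: is_derive_h1; rewrite ?tge0//= (le_lt_trans tb)// (le_lt_trans be).
have t1 : t <= 1 by rewrite (le_trans tb)// (le_trans be)// ltW.
rewrite /h2 divr_ge0 ?exprn_even_ge0// mulr_ge0 ?mulr_ge0//.
by apply: tilt_curvature_ge0; rewrite ?tge0// ltW.
Qed.
End tilt.

(** * Exceedances along a chain of cells *)

(** Expanding the product of the fibre sums enumerates the families [f] lying over [g]. It
    transports product laws along the embedding into [cell] and along [merge j]. *)
Lemma sum_prod_pushforward (R : comPzSemiRingType) (I A B : finType) (h : A -> B)
    (q : A -> R) (p : pred {ffun I -> B}) :
  \sum_(f : {ffun I -> A} | p [ffun i => h (f i)]) \prod_i q (f i) =
  \sum_(g | p g) \prod_i \sum_(c | h c == g i) q c.
Proof.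
rewrite (partition_big (fun f : {ffun I -> A} => [ffun i => h (f i)]) p)//=.
apply: eq_bigr => g pg; rewrite bigA_distr_big_dep/=.
apply: eq_bigl => f; apply/andP/familyP => [[_ /eqP <-] i|fg].
  by rewrite ffunE unfold_in.
have -> : [ffun i => h (f i)] = g.
  by apply/ffunP => i; rewrite ffunE; apply/eqP; have := fg i; rewrite unfold_in.
by [].
Qed.

Section chain.
Variables (R : realFieldType) (C : finType) (M n : nat).
Variables (S : 'I_M -> {set C}) (q : C -> R) (a K : R) (bad : 'I_M -> pred nat).
Hypothesis S_chain : forall i j : 'I_M, (i <= j)%N -> S i \subset S j.
Hypothesis q_ge0 : forall c, 0 <= q c.
Hypothesis q_sum : \sum_c q c = 1.
Hypothesis a_ge0 : 0 <= a.
Hypothesis K_ge0 : 0 <= K.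
Let Q j := \sum_(c in S j) q c.
(** The bound [K] on the likelihood ratio, written without a quotient because [Q j + a] may
    vanish. *)
Hypothesis bad_le : forall j k, (k <= n)%N -> bad j k ->
  Q j ^+ k * (1 + a) ^+ n <= K * (Q j + a) ^+ k.

(* [None] is the extra atom of mass [a], which lies in every set of the chain; it
   also represents the class of all cells identified by [merge j]. *)
Let cell := option C.
Let inS j (o : cell) := if o is Some c then c \in S j else true.
Let cnt j (g : {ffun 'I_n -> cell}) := #|[pred i | inS j (g i)]|.
(** The event [tau = j] of the stopping argument. *)
Let last_bad j g :=
  bad j (cnt j g) && [forall i : 'I_M, (j < i)%N ==> ~~ bad i (cnt i g)].
Let merge j (o : cell) : cell :=
  if o is Some c then if c \in S j then None else Some c else None.
(** [w] is the sampling law carried over to [cell], [w0] the law tilted by the atom of mass [a] and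
    renormalized; [u j] and [u0 j] are their images under [merge j]. *)
Let w (o : cell) : R := if o is Some c then q c else 0.
Let w0 (o : cell) : R := if o is Some c then q c / (1 + a) else a / (1 + a).
Let u j (o : cell) := \sum_(c | merge j c == o) w c.
Let u0 j (o : cell) := \sum_(c | merge j c == o) w0 c.

Let a1_gt0 : 0 < 1 + a. Proof. by rewrite ltr_wpDr. Qed.

Let big_cell (F : cell -> R) (P : pred cell) :
  \sum_(o | P o) F o = (if P None then F None else 0) + \sum_(c | P (Some c)) F (Some c).
Proof.
rewrite big_mkcond (bigD1 None)//= [X in _ + X = _](reindex_omap Some id)/=; last by case.
by rewrite [in RHS]big_mkcond; congr (_ + _); apply: eq_bigl => c; rewrite eqxx.
Qed.

Let uN j : u j None = Q j.
Proof.
rewrite /u big_cell /= add0r; apply: eq_bigl => c /=.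
by case: ifP; rewrite ?eqxx.
Qed.

Let u0N j : u0 j None = (Q j + a) / (1 + a).
Proof.
rewrite /u0 big_cell /= addrC mulrDl mulr_suml; congr (_ + _).
by apply: eq_bigl => c /=; case: ifP; rewrite ?eqxx.
Qed.

Let u0S j c : u0 j (Some c) = u j (Some c) / (1 + a).
Proof. by rewrite /u0 /u !big_cell /= !add0r mulr_suml. Qed.

Let uS_ge0 j o : 0 <= u j o.
Proof. by apply: sumr_ge0 => -[]/=. Qed.

Let uS_in j c : c \in S j -> u j (Some c) = 0.
Proof.
move=> cS; rewrite /u big_cell /= add0r big1 // => d.
by case: ifP => // dS /eqP[dc]; rewrite -dc dS in cS *.
Qed.

(** Only the counts in [S k] with [j <= k] matter. Each such [S k] contains [S j], and [None] lies
    in all of them, so merging [S j] into [None] changes no count. *)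
Let last_bad_merge j (g : {ffun 'I_n -> cell}) :
  last_bad j [ffun i => merge j (g i)] = last_bad j g.
Proof.
have E (k : 'I_M) : (j <= k)%N -> cnt k [ffun i => merge j (g i)] = cnt k g.
  move=> jk; apply: eq_card => i; rewrite !inE ffunE.
  case: (g i) => //= c; case: ifP => //= cS.
  by rewrite (fintype.subsetP (S_chain jk)).
rewrite /last_bad E//; congr andb; apply: eq_forallb => k.
by case: (ltnP j k) => //= jk; rewrite E// ltnW.
Qed.

Let prod_u_le j (g : {ffun 'I_n -> cell}) :
  last_bad j g -> \prod_i u j (g i) <= K * \prod_i u0 j (g i).
Proof.
move=> /andP[bj _].
have u0E i : u0 j (g i) = (if g i is Some _ then u j (g i) else Q j + a) / (1 + a).
  by case: (g i) => [c|]; rewrite ?u0S ?u0N.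
under [X in _ <= K * X]eq_bigr do rewrite u0E.
rewrite prodf_div prodr_const card_ord mulrA ler_pdivlMr ?exprn_gt0//.
(* An unmerged cell of [S j] has weight 0 on both sides. Otherwise every coordinate in [S j] is
   [None] and contributes [Q j] against [Q j + a], while the others contribute equally. *)
have [/existsP[i /andP[gS gN]]|/existsPn allN] :=
    boolP [exists i, inS j (g i) && (g i != None)].
  rewrite (bigD1 i)//= [X in _ <= K * X](bigD1 i)//=.
  by case: (g i) gS gN => //= c cS _; rewrite uS_in// !mul0r mulr0.
have gN i : inS j (g i) -> g i = None.
  by move=> gS; apply/eqP; have := allN i; rewrite gS /= negbK.
rewrite (bigID (fun i => inS j (g i)))/= [X in _ <= K * X](bigID (fun i => inS j (g i)))/=.
rewrite (eq_bigr (fun=> Q j)); last by move=> i /gN ->; rewrite uN.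
rewrite prodr_const [X in _ <= K * (X * _)](eq_bigr (fun=> Q j + a)); last by move=> i /gN ->.
rewrite prodr_const.
rewrite [X in _ <= K * (_ * X)](eq_bigr (fun i => u j (g i))); last first.
  by move=> i; case: (g i).
rewrite mulrAC mulrA; apply: ler_wpM2r; first exact: prodr_ge0.
by apply: bad_le => //; rewrite -[leqRHS]card_ord max_card.
Qed.

Let w0_sum : \sum_o w0 o = 1.
Proof.
rewrite (big_cell w0 predT) /= -mulr_suml q_sum -mulrDl addrC divff//.
by rewrite gt_eqF.
Qed.

Let w0_ge0 o : 0 <= w0 o.
Proof. by case: o => [c|]; rewrite divr_ge0// ltW. Qed.

Lemma last_exceedance_bound :
  \sum_(f : {ffun 'I_n -> C} | [exists j, bad j #|[pred i | f i \in S j]|])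
    \prod_i q (f i) <= K.
Proof.
pose embed (f : {ffun 'I_n -> C}) : {ffun 'I_n -> cell} := [ffun i => Some (f i)].
have cntE j f : cnt j (embed f) = #|[pred i | f i \in S j]|.
  by apply: eq_card => i; rewrite !inE ffunE.
have prod_ge0 (f : {ffun 'I_n -> C}) : 0 <= \prod_i q (f i) by exact: prodr_ge0.
apply: (@le_trans _ _ (\sum_j \sum_(f | last_bad j (embed f)) \prod_i q (f i))).
  under [leRHS]eq_bigr do rewrite big_mkcond.
  rewrite exchange_big/= [leLHS]big_mkcond; apply: ler_sum => f _.
  case: ifP => [/existsP[j0 bj0]|_]; last first.
    by apply: sumr_ge0 => j _; case: ifP.
  have [j bj jmax] := @arg_maxnP _ j0 (fun j => bad j (cnt j (embed f))) (@nat_of_ord M)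
    ltac:(by rewrite /= cntE).
  rewrite (bigD1 j)//= ifT ?lerDl; last first.
    rewrite /last_bad bj; apply/forallP => i; apply/implyP; apply: contraTN => bi.
    by rewrite -leqNgt; exact: jmax.
  by apply: sumr_ge0 => i _; case: ifP.
(* Change of law, separately on each event: push both laws along [merge j] and compare them by
   [prod_u_le]. *)
apply: (@le_trans _ _ (\sum_j K * \sum_(g | last_bad j g) \prod_i w0 (g i))).
  apply: ler_sum => j _.
  have -> : \sum_(f | last_bad j (embed f)) \prod_i q (f i) =
            \sum_(g | last_bad j g) \prod_i w (g i).
    rewrite /embed sum_prod_pushforward; apply: eq_bigr => g _; apply: eq_bigr => i _.
    case: (g i) => [c|]; last by rewrite big_pred0.
    by rewrite (big_pred1 c).
  have push v : \sum_(g | last_bad j g) \prod_i v (g i) =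
      \sum_(g | last_bad j g) \prod_i \sum_(o | merge j o == g i) v o :> R.
    rewrite -sum_prod_pushforward; apply: eq_bigl => g.
    by rewrite last_bad_merge.
  by rewrite push [in leRHS]push mulr_sumr; apply: ler_sum => g; exact: prod_u_le.
rewrite -mulr_sumr ler_piMr//.
(* The events [last_bad j] are disjoint, so their masses under [w0] add up to at most 1. *)
under eq_bigr do rewrite big_mkcond.
rewrite exchange_big/=.
have sum1 : \sum_(g : {ffun 'I_n -> cell}) \prod_i w0 (g i) = 1.
  by rewrite -(bigA_distr_bigA (fun=> w0))/= big1.
rewrite -[leRHS]sum1.
apply: ler_sum => g _.
have p0 : 0 <= \prod_i w0 (g i) by exact: prodr_ge0.
have [/existsP[j bj]|/existsPn nb] := boolP [exists j, last_bad j g]; last first.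
  by rewrite big1// => j _; rewrite (negbTE (nb j)).
rewrite (bigD1 j)//= bj [X in _ + X]big1 ?addr0// => i ij; case: ifP => // bi.
have /andP[bj1 /forallP bj2] := bj; have /andP[bi1 /forallP bi2] := bi.
have := bj2 i; have := bi2 j; rewrite bj1 bi1 /= !implybF -!leqNgt => ji ij'.
by move: ij; rewrite -val_eqE /= eqn_leq ji ij'.
Qed.

End chain.

(** * The Dvoretzky-Kiefer-Wolfowitz inequality *)

Lemma finite_dkw (R : realType) (C : finType) (M n : nat) (S : 'I_M -> {set C})
    (q : C -> R) (e : R) :
  (forall i j : 'I_M, (i <= j)%N -> S i \subset S j) ->
  (forall c, 0 <= q c) -> \sum_c q c = 1 -> 0 < e ->
  \sum_(f : {ffun 'I_n -> C} | [exists j,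
      n%:R * (\sum_(c in S j) q c + e) <= #|[pred i | f i \in S j]|%:R])
    \prod_i q (f i) <= expR (- 2 * n%:R * e ^+ 2).
Proof.
move=> S_chain q_ge0 q_sum e0.
(* [tilt e] is meaningless for [1 <= e], but then only null sets can be exceeded. *)
pose a : R := if e < 1 then tilt e else 0.
have a0 : 0 <= a by rewrite /a; case: ifP => // e1; rewrite tilt_ge0// e1 ltW.
apply: (@last_exceedance_bound R C M n S q a (expR (- 2 * n%:R * e ^+ 2))
  (fun j k => n%:R * (\sum_(c in S j) q c + e) <= k%:R)) => //.
move=> j k kn; set x := \sum_(c in S j) q c => bk.
have x0 : 0 <= x by exact: sumr_ge0.
have [n0|n0] := posnP n.
  have -> : k = 0%N by apply/eqP; rewrite -leqn0 -n0.
  by rewrite n0 !expr0 !mulr1 mulr0 mul0r expR0.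
have n0R : 0 < n%:R :> R by rewrite ltr0n.
(* Exceeding a null set takes [k > 0] samples in it, so the left side is 0. *)
have [->|xN0] := eqVneq x 0.
  have k0 : (0 < k)%N.
    by rewrite -(ltr0n R) (lt_le_trans _ bk)// mulr_gt0// ltr_wpDl.
  by rewrite expr0n gtn_eqF//= mul0r mulr_ge0 ?expR_ge0// exprn_ge0// add0r.
have xp : 0 < x by rewrite lt_def xN0.
(* Since [k <= n], an exceedance forces [x + e <= 1]. *)
have e1 : e < 1.
  have : n%:R * (x + e) <= n%:R * 1 :> R by rewrite mulr1 (le_trans bk)// ler_nat.
  by rewrite ler_pM2l//; lra.
have aE : a = tilt e by rewrite /a e1.
have xa : 0 < x + a by rewrite ltr_wpDr.
have a1 : 0 < 1 + a by rewrite ltr_wpDr.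
have Lx : x ^+ k = expR (k%:R * ln x).
  by rewrite mulr_natl -lnXn// lnK// posrE exprn_gt0.
have Lxa : (x + a) ^+ k = expR (k%:R * ln (x + a)).
  by rewrite mulr_natl -lnXn// lnK// posrE exprn_gt0.
have L1a : (1 + a) ^+ n = expR (n%:R * ln (1 + a)).
  by rewrite mulr_natl -lnXn// lnK// posrE exprn_gt0.
rewrite Lx Lxa L1a -!expRD ler_expR.
(* The logarithmic gain per sample is nonnegative, so [k] may be lowered to [n (x + e)], where
   [tilt_le] multiplied by [n] concludes. *)
have ln0 : 0 <= ln (x + a) - ln x by rewrite subr_ge0 ler_ln ?posrE// lerDl.
have h1 := ler_wpM2r ln0 bk.
have e01 : 0 <= e < 1 by rewrite ltW.
have := tilt_le xp e01; rewrite -aE => /(ler_wpM2l (ltW n0R)) h2.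
have := le_trans h2 (eq_ind_r (fun y => y <= _) h1 (mulrA _ _ _)).
rewrite mulrDr mulrBr; lra.
Qed.

(** * Reduction of a real sample to finitely many cells *)

Section cells.
Variables (d : measure_display) (T : measurableType d) (R : realType).
Variables (P : probability T R) (k : nat) (X : 'I_k -> {RV P >-> R}) (H : R -> R).
Hypothesis k_gt0 : (0 < k)%N.
Hypothesis iidX : iid_with_cdf X H.
Variable s : seq R.
Hypothesis s_sorted : sorted <=%R s.
Let M := size s.

Let PX i x : P [set w | X i w <= x] = (H x)%:E.
Proof.
case: iidX => _ /(_ i x) <-; rewrite /cdf /distribution /pushforward.
by congr (P _); apply/seteqP; split => w /=; rewrite in_itv.
Qed.

(** The first threshold at or above [y], or [M] if there is none; hence [M.+1] cells. *)
Let pos (y : R) := find (fun x => y <= x) s.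

Let posE (j : 'I_M) y : (pos y <= j)%N = (y <= nth 0 s j).
Proof.
apply/idP/idP => [pj|yj]; last first.
  by rewrite leqNgt; apply/negP => /(before_find 0); rewrite yj.
have ps : (pos y < size s)%N by rewrite (leq_ltn_trans pj).
have := ps; rewrite -has_find => /(nth_find 0) /le_trans; apply.
by apply: (sorted_leq_nth le_trans le_refl) => //; rewrite inE.
Qed.

Let posM y : (pos y < M.+1)%N. Proof. by rewrite ltnS find_size. Qed.

Let cell y : 'I_M.+1 := Ordinal (posM y).

(** The mass of [below c]; the shift by one makes [h 0 = 0] and [h M.+1 = 1] the ends of a
    telescoping sum. *)
Let h c : R := if c is c'.+1 then if (c' < M)%N then H (nth 0 s c') else 1 else 0.

Let q (c : 'I_M.+1) := h c.+1 - h c.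

Let below c := [set y | (pos y < c)%N].

Let belowE c : below c = if c is c'.+1 then
  if (c' < M)%N then [set y | y <= nth 0 s c'] else setT else set0.
Proof.
apply/seteqP; case: c => [|c]; split => y //=.
  by case: ltnP => // cM; rewrite /below /= ltnS (posE (Ordinal cM)).
case: ltnP => [cM|Mc _]; first by rewrite /below /= ltnS (posE (Ordinal cM)).
by rewrite /below /= (leq_trans (posM y)).
Qed.

Let mbelow c : measurable (below c).
Proof.
rewrite belowE; case: c => // c; case: ifP => // _.
exact: (measurable_itv `]-oo, nth 0 s c]).
Qed.

Let Pbelow i c : P (X i @^-1` below c) = (h c)%:E.
Proof.
rewrite belowE /h; case: c => [|c]; first by rewrite preimage_set0 measure0.
case: ifP => _; first by rewrite -(PX i).
by rewrite preimage_setT probability_setT.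
Qed.

Let mX i A : measurable A -> measurable (X i @^-1` A).
Proof. by move=> mA; rewrite -[_ @^-1` _]setTI; exact: measurable_funP. Qed.

Let cellset c := below c.+1 `\` below c.

Let cellsetP (c : 'I_M.+1) y : cellset c y <-> cell y = c.
Proof.
rewrite /cellset /below /=; split => [[]|<-/=].
  by rewrite ltnS => yc /negP; rewrite -leqNgt => cy; apply/val_inj/eqP; rewrite eqn_leq /= yc.
by split => //; rewrite ltnn.
Qed.

Let Pcell i (c : 'I_M.+1) : P (X i @^-1` cellset c) = (q c)%:E.
Proof.
rewrite (_ : _ @^-1` _ = X i @^-1` below c.+1 `\` X i @^-1` below c)//.
rewrite measureD; [|exact: mX|exact: mX|]; last first.
  by rewrite -ge0_fin_numE// fin_num_measure//; exact: mX.
rewrite setIidr; last by move=> w; rewrite /below /= ltnS => /ltnW.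
by rewrite /q EFinB; congr (_ - _)%E; exact: Pbelow.
Qed.

Let q_ge0 c : 0 <= q c.
Proof. by rewrite -lee_fin -(Pcell (Ordinal k_gt0)). Qed.

Let q_sum_below (j : nat) : (j <= M)%N -> \sum_(c : 'I_M.+1 | (c <= j)%N) q c = h j.+1.
Proof.
move=> jM; rewrite /q -[RHS]subr0 -[in RHS](telescope_sumr (h : nat -> R) (leq0n j.+1)).
by rewrite big_mkord (big_ord_widen M.+1 (fun c => h c.+1 - h c)).
Qed.

Let q_sum : \sum_c q c = 1.
Proof.
have := q_sum_below (leqnn M); rewrite /h ltnn => <-.
by apply: eq_bigl => c; rewrite -ltnS ltn_ord.
Qed.

(** The event is a finite union over the cell vectors satisfying [p]; each piece factorizes by
    independence, and subadditivity gives the bound. *)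
Let cell_prob_le (p : pred {ffun 'I_k -> 'I_M.+1}) :
  measurable [set w | p [ffun i => cell (X i w)]] /\
  (P [set w | p [ffun i => cell (X i w)]] <=
    (\sum_(f | p f) \prod_i q (f i))%:E)%E.
Proof.
pose A (f : {ffun 'I_k -> 'I_M.+1}) :=
  \bigcap_(i in [set` [set: 'I_k]%SET]) (X i @^-1` cellset (f i)).
have mA f : measurable (A f).
  apply: fin_bigcap_measurable => // i _; apply: mX; exact: measurableD.
have AE f w : A f w <-> [ffun i => cell (X i w)] = f.
  split => [Af|<- i _ /=]; last by apply/cellsetP; rewrite ffunE.
  by apply/ffunP => i; rewrite ffunE; apply/cellsetP/Af; rewrite /= inE.
have -> : [set w | p [ffun i => cell (X i w)]] = \big[setU/set0]_(f | p f) A f.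
  rewrite -bigcup_seq_cond; apply/seteqP; split => w /=.
    move=> pw; exists [ffun i => cell (X i w)]; last exact/AE.
    by rewrite /= mem_index_enum.
  by move=> [f /= /andP[_ pf] /AE ->].
split; first by apply: bigsetU_measurable => f _.
have PA f : P (A f) = (\prod_i q (f i))%:E.
  rewrite /A (iidX.1 [set: 'I_k]%SET (fun i => cellset (f i))); last first.
    by move=> i; exact: measurableD.
  rewrite -prodEFin; apply: eq_big => [i|i _]; first by rewrite inE.
  exact: Pcell.
rewrite -sumEFin; elim: (index_enum _) => [|f r IH]; first by rewrite !big_nil measure0.
rewrite !big_cons; case: ifP => // _.
apply: le_trans (measureU2 _ _ _) _ => //; first exact: bigsetU_measurable.
by apply: leeD => //; rewrite -PA.
Qed.

Lemma exceed_above_le e : 0 < e ->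
  let E := [set w | [exists j : 'I_M, k%:R * (H (nth 0 s j) + e) <=
       #|[pred i | X i w <= nth 0 s j]|%:R]] in
  measurable E /\ (P E <= (expR (- 2 * k%:R * e ^+ 2))%:E)%E.
Proof.
move=> e0.
pose S (j : 'I_M) : {set 'I_M.+1} := [set c : 'I_M.+1 | (c <= j)%N]%SET.
have QE j : \sum_(c in S j) q c = H (nth 0 s j).
  under eq_bigl do rewrite inE.
  by rewrite q_sum_below ?(ltnW (ltn_ord _))// /h ltn_ord.
have := @cell_prob_le (fun f => [exists j,
      k%:R * (\sum_(c in S j) q c + e) <= #|[pred i | f i \in S j]|%:R]).
set E1 := [set w | _]; move=> [mE1 PE1] E.
have -> : E = E1.
  apply/seteqP; split => w /= /existsP[j jE]; apply/existsP; exists j; move: jE;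
  rewrite QE (_ : #|_| = #|[pred i | X i w <= nth 0 s j]|)//;
  by apply: eq_card => i; rewrite !inE ffunE /= posE.
split => //; apply: (le_trans PE1); rewrite lee_fin; apply: finite_dkw => //.
by move=> i j ij; apply/fintype.subsetP => c; rewrite !inE => /leq_trans; apply.
Qed.

(** Too few samples below a threshold means too many above it: an upper segment of cells has mass
    [1 - H] and count [k] minus the lower count. [rev_ord] makes these segments an increasing
    chain. *)
Lemma exceed_below_le e : 0 < e ->
  let E := [set w | [exists j : 'I_M, #|[pred i | X i w <= nth 0 s j]|%:R <=
    k%:R * (H (nth 0 s j) - e)]] in
  measurable E /\ (P E <= (expR (- 2 * k%:R * e ^+ 2))%:E)%E.
Proof.
move=> e0.
pose S (j : 'I_M) : {set 'I_M.+1} := [set c : 'I_M.+1 | (rev_ord j < c)%N]%SET.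
have QE j : \sum_(c in S j) q c = 1 - H (nth 0 s (rev_ord j)).
  apply/eqP; rewrite eq_sym subr_eq -q_sum (bigID (fun c => c \in S j))/=.
  under [X in _ + X == _]eq_bigl do rewrite inE -leqNgt.
  by rewrite q_sum_below ?(ltnW (ltn_ord _))// /h ltn_ord.
have := @cell_prob_le (fun f => [exists j,
      k%:R * (\sum_(c in S j) q c + e) <= #|[pred i | f i \in S j]|%:R]).
set E1 := [set w | _]; move=> [mE1 PE1] E.
have cE w j : #|[pred i | [ffun i => cell (X i w)] i \in S j]|%:R =
    k%:R - #|[pred i | X i w <= nth 0 s (rev_ord j)]|%:R :> R.
  have := cardC [pred i | X i w <= nth 0 s (rev_ord j)]; rewrite card_ord => kE.
  rewrite -[X in X%:R - _]kE natrD addrAC subrr add0r; congr (_%:R); apply: eq_card => i.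
  by rewrite !inE ffunE -posE -ltnNge.
have -> : E = E1.
  apply/seteqP; split => w /= /existsP[j jE]; apply/existsP; exists (rev_ord j);
  move: jE; rewrite QE cE ?rev_ordK; lra.
split => //; apply: (le_trans PE1); rewrite lee_fin; apply: finite_dkw => //.
move=> i j ij; apply/fintype.subsetP => c; rewrite !inE; apply: leq_ltn_trans.
by rewrite /= leq_sub2l.
Qed.
End cells.

(** * From finitely many thresholds to all reals *)

Definition rat_seq (R : realType) (n : nat) : R :=
  ratr (odflt 0 (@choice.unpickle rat n)).

Lemma right_continuous_lt_rat_seq (R : realType) (g : R -> R) (s x : R) :
  g y @[y --> x^'+] --> g x -> s < g x -> exists n, s < g (rat_seq R n).
Proof.
move=> gx sg; have /cvgr_gt/(_ _ sg) := gx.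
rewrite near_withinE => /nbhs_ballP[e /= e0 xe].
have /rat_in_itvoo[r /itvP rI] : x < x + e by rewrite ltrDl.
(* The pickle of a rational is its index; [odflt 0] only fills the indices that encode no
   rational. *)
exists (choice.pickle r); rewrite /rat_seq choice.pickleK /=; apply: xe; rewrite ?rI//.
rewrite /ball /= distrC ltr_norml !ltrBlDl !ltrBrDl !rI andbT.
by rewrite (lt_trans _ (_ : x < _)) ?rI// gtrDl oppr_lt0.
Qed.

Lemma ecdf_near_right (R : realType) (k : nat) (s : 'I_k -> R) (x : R) :
  \forall y \near x^'+, ecdf s y = ecdf s x.
Proof.
have H : \forall y \near x^'+, forall i : 'I_k, (s i <= y) = (s i <= x).
  apply: filter_forall => i; have [sx|xs] := leP (s i) x.
    near=> y; apply: (le_trans sx); near: y.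
    by apply: filterS (nbhs_right_gt x) => y /ltW.
  by apply: filterS (nbhs_right_lt xs) => y ys; rewrite leNgt ys.
apply: filterS H => y sE; rewrite /ecdf; congr (_%:R / _).
by apply: eq_card => i; rewrite !inE sE.
Unshelve. all: by end_near. Qed.

Lemma ecdf_right_continuous (R : realType) (k : nat) (s : 'I_k -> R) (x : R) :
  ecdf s y @[y --> x^'+] --> ecdf s x.
Proof. exact: cvg_near_cst (ecdf_near_right s x). Qed.

Section dkw.
Variables (d : measure_display) (T : measurableType d) (R : realType).
Variables (P : probability T R) (k : nat) (X : 'I_k -> {RV P >-> R}) (H : R -> R).
Hypothesis k_gt0 : (0 < k)%N.
Hypothesis iidX : iid_with_cdf X H.

Let dev (w : T) (x : R) : R := `|H x - ecdf (fun i => X i w) x|.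

Lemma iid_cdf_right_continuous x : H y @[y --> x^'+] --> H x.
Proof.
case: iidX => _ XH; have := @cdf_right_continuous _ _ _ P (X (Ordinal k_gt0)) x.
by rewrite XH => /fine_cvg; apply: cvg_trans; apply: near_eq_cvg; near=> y; rewrite /= XH.
Unshelve. all: by end_near. Qed.

Lemma dkw_finite (s : seq R) e : 0 < e ->
  let E := [set w | has (fun x => e <= dev w x) s] in
  measurable E /\ (P E <= (2 * expR (- 2 * k%:R * e ^+ 2))%:E)%E.
Proof.
move=> e0 E; pose s' := sort <=%R s.
have s's : sorted <=%R s' by apply: sort_sorted; exact: le_total.
have [mA PA] := exceed_above_le k_gt0 iidX s's e0.
have [mB PB] := exceed_below_le k_gt0 iidX s's e0.
move: mA PA mB PB; set A := [set w | _]; set B := [set w | _] => mA PA mB PB.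
have k0 : 0 < k%:R :> R by rewrite ltr0n.
have EAB : E = A `|` B.
  rewrite /E; under eq_set do rewrite -(eq_has_r (mem_sort <=%R s)) -/s'.
  apply/seteqP; split => w /=.
    move=> /(has_nthP 0)[j js]; rewrite /dev ler_normr => /orP[h|h].
      right; apply/existsP; exists (Ordinal js) => /=.
      by rewrite -ler_pdivrMl// mulrC; rewrite /ecdf in h; lra.
    left; apply/existsP; exists (Ordinal js) => /=.
    by rewrite -ler_pdivlMl// mulrC; rewrite /ecdf in h; lra.
  move=> [/existsP[j jE]|/existsP[j jE]]; apply/(has_nthP 0); exists j => //;
    rewrite /dev ler_normr /ecdf; apply/orP; [right|left].
    by rewrite -ler_pdivlMl// mulrC in jE; lra.
  by rewrite -ler_pdivrMl// mulrC in jE; lra.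
rewrite EAB; split; first exact: measurableU.
apply: (le_trans (measureU2 _ _ _)) => //.
by rewrite mulr_natl mulr2n EFinD; exact: leeD.
Qed.

(** Continuity from below along growing prefixes of the enumeration, the finite bound being uniform
    in the prefix. *)
Lemma dkw_rat e : 0 < e ->
  let E := [set w | exists n, e <= dev w (rat_seq R n)] in
  measurable E /\ (P E <= (2 * expR (- 2 * k%:R * e ^+ 2))%:E)%E.
Proof.
move=> e0 E; pose A N := [set w | has (fun x => e <= dev w x) (mkseq (rat_seq R) N)].
have mA N : measurable (A N) by have [] := dkw_finite (mkseq (rat_seq R) N) e0.
have EA : E = \bigcup_N A N.
  apply/seteqP; split => w /=.
    move=> [n en]; exists n.+1 => //=; apply/hasP; exists (rat_seq R n) => //.
    by apply/mapP; exists n; rewrite // mem_iota /= add0n ltnSn.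
  by move=> [N _ /hasP[_ /mapP[n _ ->] en]]; exists n.
have mE : measurable (\bigcup_N A N) by exact: bigcup_measurable.
have ndA : nondecreasing_seq A.
  move=> m n mn; apply/subsetPset => w /hasP[_ /mapP[i im ->] ei]; apply/hasP.
  exists (rat_seq R i) => //; apply/mapP; exists i => //.
  by move: im; rewrite !mem_iota /= !add0n => /leq_trans; apply.
rewrite EA; split => //.
have cv := nondecreasing_cvg_mu (mu := P) mA mE ndA.
rewrite -(cvg_lim _ cv)//; apply: lime_le; first by apply/cvg_ex; eexists; exact: cv.
by apply: nearW => N; have [] := dkw_finite (mkseq (rat_seq R) N) e0.
Qed.

(* The supremum event is covered by a measurable set [B], so that no measurability
   of the supremum is required here. *)
Lemma dkw t : 0 <= t -> exists B : set T,
  [/\ measurable B, (P B <= (2 * expR (- 2 * k%:R * t ^+ 2))%:E)%E &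
      forall w, ~ B w -> exists2 s, s < t & forall x, dev w x <= s].
Proof.
rewrite le_eqVlt => /predU1P[<-|t0].
  exists setT; split; [exact: measurableT| |by move=> w []].
  by rewrite probability_setT expr0n mulr0 expR0 lee_fin mulr1 ler1n.
(* Levels strictly below [t] that tend to [t]; halving the harmonic term keeps [s 0] positive. *)
pose s i : R := t * (1 - harmonic i / 2).
have s0 i : 0 < s i.
  rewrite mulr_gt0// subr_gt0 ltr_pdivrMr// mul1r /harmonic/=.
  by rewrite (le_lt_trans _ (_ : 1 < 2)) ?ltr1n// invf_le1// ler1n.
have st i : s i < t.
  by rewrite /s gtr_pMr// gtrDl oppr_lt0 divr_gt0// /harmonic /= invr_gt0.
pose E i := [set w | exists n, s i <= dev w (rat_seq R n)].
have mE i : measurable (E i) by have [] := dkw_rat (s0 i).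
exists (\bigcap_i E i); split; first exact: bigcapT_measurable.
- have mB : measurable (\bigcap_i E i) by exact: bigcapT_measurable.
  rewrite -(fineK (fin_num_measure P _ mB)) lee_fin.
  have cs : s i @[i --> \oo] --> t.
    have -> : t = t * (1 - 0 * 2^-1) by rewrite mul0r subr0 mulr1.
    apply: cvgMl_tmp; apply: cvgB; first exact: cvg_cst.
    by apply: cvgMr_tmp; exact: cvg_harmonic.
  have cB : 2 * expR (- 2 * k%:R * s i ^+ 2) @[i --> \oo] --> 2 * expR (- 2 * k%:R * t ^+ 2).
    apply: cvgMl_tmp; apply: (cvg_comp (fun i => - 2 * k%:R * s i ^+ 2) (@expR R) _
      (@continuous_expR R _)).
    by apply: cvgMl_tmp; apply: (cvg_comp s (fun y : R => y ^+ 2) cs); exact: exprn_continuous.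
  apply: cvgr_to_ge cB _; apply: nearW => i.
  rewrite -lee_fin fineK ?fin_num_measure//.
  have [_] := dkw_rat (s0 i); apply: le_trans.
  by apply: le_measure; rewrite ?inE; [exact: mB|exact: (mE i)|move=> w /(_ i I)].
(* Outside [B] some level [s i] is reached at no rational, and right continuity extends the bound to
   every real. *)
- move=> w /existsNP[i /not_implyP[_ wE]]; exists (s i) => // x.
  rewrite leNgt; apply/negP => sx; apply: wE.
  have [|n sn] := @right_continuous_lt_rat_seq R (dev w) (s i) x _ sx.
    apply: cvg_norm; apply: cvgB; first exact: iid_cdf_right_continuous.
    exact: ecdf_right_continuous.
  by exists n; exact: ltW.
Qed.
End dkw.

(** * Censored feedback *)

(* When [c = 0] the division yields [expR 0], and the bound is trivial. *)
Lemma weighted_dkw d (T : measurableType d) (R : realType) (P : probability T R)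
    (k : nat) (X : 'I_k -> {RV P >-> R}) (H : R -> R) (eta b c : R) :
  (0 < k)%N -> iid_with_cdf X H -> b <= eta -> 0 <= c ->
  exists B : set T, [/\ measurable B,
    (P B <= (2 * expR (- 2 * k%:R * (eta - b) ^+ 2 / c ^+ 2))%:E)%E &
    forall w, ~ B w -> exists2 s, s < eta &
      forall x, b + c * `|H x - ecdf (fun i => X i w) x| <= s].
Proof.
move=> k0 iidX beta; rewrite le_eqVlt => /predU1P[<-|c0].
  exists setT; split; [exact: measurableT| |by move=> w []].
  by rewrite probability_setT expr0n invr0 mulr0 expR0 lee_fin mulr1 ler1n.
(* The level at which the weighted distance plus the bias [b] reaches [eta]. *)
have t0 : 0 <= (eta - b) / c by rewrite divr_ge0 ?subr_ge0// ltW.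
have [B [mB PB Bs]] := dkw k0 iidX t0.
exists B; split => //; first by rewrite -mulrA -expr_div_n.
move=> w /Bs[s st sd]; exists (b + c * s).
  by rewrite -ltrBrDl mulrC -ltr_pdivlMr.
by move=> x; rewrite lerD2l ler_pM2l.
Qed.

(** As [D] detects every strict exceedance, the event is a countable intersection, over levels
    increasing to [eta], of countable unions. Boundedness makes [sup] a true least upper bound. *)
Lemma measurable_le_sup d (T : measurableType d) (R : realType)
    (g : R -> T -> R) (D : nat -> R) (eta : R) :
  (forall x, measurable_fun setT (g x)) ->
  (forall w, exists M, forall x, g x w <= M) ->
  (forall w s x, s < g x w -> exists n, s < g (D n) w) ->
  measurable [set w | eta <= sup [set g x w | x in [set: R]]].
Proof.
move=> mg bg dg.
have -> : [set w | eta <= sup [set g x w | x in [set: R]]] =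
    \bigcap_i \bigcup_n [set w | eta - harmonic i < g (D n) w].
  apply/seteqP; split => w /=.
    move=> le_eta i _; have i0 : 0 < harmonic i :> R by rewrite /harmonic /= invr_gt0.
    have lt_sup : eta - harmonic i < sup [set g x w | x in [set: R]].
      by rewrite (lt_le_trans _ le_eta)// gtrDl oppr_lt0.
    have [|_ [x _ <-] /dg[n ln]] := sup_gt _ lt_sup; first by exists (g 0 w), 0.
    by exists n.
  move=> H; apply/ler_addgt0Pr => e e0.
  have /cvgr_lt/(_ _ e0) : harmonic n @[n --> \oo] --> (0 : R) by exact: cvg_harmonic.
  move=> [i _ /(_ i (leqnn i)) ie]; have [n _ /= ln] := H i I.
  rewrite -lerBlDr; apply/ltW; apply: (@lt_trans _ _ (eta - harmonic i)).
    by rewrite ltrD2l ltrN2.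
  apply: (lt_le_trans ln); apply: ub_le_sup; last by exists (D n).
  by have [M gM] := bg w; exists M => _ [x _ <-].
apply: bigcapT_measurable => i; apply: bigcupT_measurable => n.
rewrite -[X in measurable X]setTI; apply: measurable_fun_ltr => //.
Qed.

Lemma measurable_ecdf d (T : measurableType d) (R : realType) (P : probability T R)
    (k : nat) (X : 'I_k -> {RV P >-> R}) (x : R) :
  measurable_fun setT (fun w => ecdf (fun i => X i w) x).
Proof.
apply: measurable_funM => //.
pose A i := X i @^-1` `]-oo, x].
rewrite (_ : (fun w => _) = (fun w => \sum_(i < k) \1_(A i) w)); last first.
  apply/funext => w; rewrite -sum1_card natr_sum big_mkcond /=.
  apply: eq_bigr => i _; rewrite indicE !inE /A.
  by case: (leP (X i w) x) => h; [rewrite mem_set//= in_itv|rewrite memNset//= in_itv /= leNgt h].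
apply: measurable_sum => i; apply: measurable_indic.
by rewrite -[A i]setTI; apply: measurable_funP.
Qed.

(** * Deterministic error bounds on the three regions *)

Lemma iid_cdf_itv d (T : measurableType d) (R : realType) (P : probability T R)
    (k : nat) (X : 'I_k -> {RV P >-> R}) (H : R -> R) x :
  (0 < k)%N -> iid_with_cdf X H -> 0 <= H x <= 1.
Proof.
move=> k0 [_ /(_ (Ordinal k0) x) XH].
by rewrite -!lee_fin -XH cdf_ge0 cdf_le1.
Qed.

Lemma ecdf_itv (R : realType) (k : nat) (s : 'I_k -> R) x : 0 <= ecdf s x <= 1.
Proof.
rewrite /ecdf divr_ge0//=; case: k s => [|k] s; first by rewrite invr0 mulr0.
rewrite ler_pdivrMr ?ltr0n// mul1r ler_nat.
by rewrite (leq_trans (max_card _))// card_ord.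
Qed.

(** Insert the mixed product that leaves the smaller weight on [h - h']; the remaining term is at
    most [|p - p'|] because its CDF value is at most 1. This is the origin of the minima in the
    theorem. *)
Lemma ler_dist_weighted (R : realDomainType) (p p' h h' : R) :
  0 <= h <= 1 -> 0 <= h' <= 1 -> 0 <= p -> 0 <= p' ->
  `|p * h - p' * h'| <= `|p - p'| + Num.min p p' * `|h - h'|.
Proof.
move=> /andP[h0 h1] /andP[h'0 h'1] p0 p'0.
have [pp'|/ltW pp'] := leP p p'.
  have -> : p * h - p' * h' = (p - p') * h' + p * (h - h') by ring.
  apply: (le_trans (ler_normD _ _)); rewrite !normrM (ger0_norm p0) (ger0_norm h'0).
  by rewrite lerD2r ler_piMr.
have -> : p * h - p' * h' = (p - p') * h + p' * (h - h') by ring.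
apply: (le_trans (ler_normD _ _)); rewrite !normrM (ger0_norm p'0) (ger0_norm h0).
by rewrite lerD2r ler_piMr.
Qed.

(** On each region both [F] and the estimate are an offset plus a weight times a CDF, so the offset
    bias adds to the bound of [ler_dist_weighted]. *)
Lemma censored_ecdf_error (R : realType) (F : R -> R) (LB theta eps : R)
    (n l m ke kd : nat) (xb : 'I_l -> R) (xe : 'I_(m - l + ke) -> R)
    (xd : 'I_(n - m + kd) -> R) (x : R) :
  let beta := F LB in
  let alpha := F theta in
  let lfrac := l%:R / n%:R : R in
  let mfrac := (n - l)%N%:R / n%:R *
    ((m - l + ke)%N%:R / ((n - l + ke)%N%:R + eps * kd%:R)) in
  let dfrac := (n - l)%N%:R / n%:R *
    (((n - m)%N%:R + eps * kd%:R) / ((n - l + ke)%N%:R + eps * kd%:R)) in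
  let err := `|F x - censored_ecdf LB theta eps xb xe xd x| in
  LB < theta -> 0 < beta -> beta < alpha -> alpha < 1 ->
  (l < n)%N -> (l <= m)%N -> (m <= n)%N -> 0 <= eps ->
  (forall y, 0 <= cdf_below F LB y <= 1) ->
  (forall y, 0 <= cdf_between F LB theta y <= 1) ->
  (forall y, 0 <= cdf_above F theta y <= 1) ->
  [\/ err <= `|beta - lfrac|
             + Num.min beta lfrac * `|cdf_below F LB x - ecdf xb x|,
      err <= `|beta - lfrac| + `|alpha - beta - mfrac|
             + Num.min (alpha - beta) mfrac
               * `|cdf_between F LB theta x - ecdf xe x|
    | err <= 2 * `|alpha - lfrac - mfrac|
             + Num.min (1 - alpha) dfrac * `|cdf_above F theta x - ecdf xd x|].
Proof.
move=> beta alpha lfrac mfrac dfrac err LBtheta beta0 ab alpha1 ln lm mn eps0 Hb He Hd.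
have n0 : 0 < n%:R :> R by rewrite ltr0n (leq_ltn_trans _ ln).
have N0 : 0 < (n - l + ke)%N%:R + eps * kd%:R :> R.
  by rewrite ltr_pwDl ?mulr_ge0// ltr0n addn_gt0 subn_gt0 ln.
have lfrac0 : 0 <= lfrac by rewrite divr_ge0.
have mfrac0 : 0 <= mfrac by rewrite mulr_ge0 ?divr_ge0// ltW.
have dfrac0 : 0 <= dfrac.
  by rewrite mulr_ge0 ?divr_ge0 ?addr_ge0 ?mulr_ge0// ltW.
have lE : lfrac + (n - l)%N%:R / n%:R = 1.
  by rewrite -mulrDl -natrD subnKC ?divff ?gt_eqF// ltnW.
have frac1 : lfrac + mfrac + dfrac = 1.
  rewrite -[RHS]lE -addrA -mulrDr -mulrDl; congr (_ + _).
  rewrite -[RHS]mulr1; congr (_ * _); rewrite addrA -natrD.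
  have -> : (m - l + ke + (n - m) = n - l + ke)%N by lia.
  by rewrite divff// gt_eqF.
have dE : (n - l)%N%:R / n%:R * (1 - explore_ratio n l m ke kd eps) = dfrac.
  by rewrite mulrBr mulr1 -[_ * explore_ratio _ _ _ _ _ _]/mfrac; lra.
rewrite /err /censored_ecdf dE -/lfrac -[_ * explore_ratio _ _ _ _ _ _]/mfrac.
have [xLB|LBx] := leP x LB.
  apply: Or31; have -> : F x = beta * cdf_below F LB x.
    by rewrite /cdf_below xLB mulrC divfK// gt_eqF.
  by apply: ler_dist_weighted; rewrite ?ecdf_itv// ltW.
have [xt|tx] := leP x theta.
  apply: Or32; have -> : F x = beta + (alpha - beta) * cdf_between F LB theta x.
    rewrite /cdf_between leNgt LBx /= xt mulrC divfK ?gt_eqF ?subr_gt0//.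
    by rewrite addrC subrK.
  have -> : beta + (alpha - beta) * cdf_between F LB theta x - (lfrac + mfrac * ecdf xe x) =
    (beta - lfrac) + ((alpha - beta) * cdf_between F LB theta x - mfrac * ecdf xe x) by ring.
  apply: (le_trans (ler_normD _ _)); rewrite -[leRHS]addrA lerD2l.
  by apply: ler_dist_weighted; rewrite ?ecdf_itv// subr_ge0 ltW.
apply: Or33; have -> : F x = alpha + (1 - alpha) * cdf_above F theta x.
  rewrite /cdf_above leNgt tx /= mulrC divfK ?gt_eqF ?subr_gt0//.
  by rewrite addrC subrK.
have -> : alpha + (1 - alpha) * cdf_above F theta x - (lfrac + mfrac + dfrac * ecdf xd x) =
  (alpha - lfrac - mfrac) + ((1 - alpha) * cdf_above F theta x - dfrac * ecdf xd x) by ring.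
apply: (le_trans (ler_normD _ _)); rewrite mulr_natl mulr2n -[leRHS]addrA lerD2l.
(* The estimated weights sum to 1, so above [theta] the weight bias equals the offset bias in
   absolute value; hence the factor 2. *)
have -> : alpha - lfrac - mfrac = - (1 - alpha - dfrac) by lra.
by rewrite normrN; apply: ler_dist_weighted; rewrite ?ecdf_itv// subr_ge0 ltW.
Qed.

(** Just to the right of [x] all comparisons with samples and region boundaries are frozen. At a
    boundary itself the next region's formula takes over, so these two points are excluded. *)
Lemma censored_ecdf_near_right (R : realType) (LB theta eps : R)
    (n l m ke kd : nat) (xb : 'I_l -> R) (xe : 'I_(m - l + ke) -> R)
    (xd : 'I_(n - m + kd) -> R) (x : R) : x != LB -> x != theta ->
  \forall y \near x^'+, censored_ecdf LB theta eps xb xe xd y =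
                        censored_ecdf LB theta eps xb xe xd x.
Proof.
have side (c : R) : x != c -> \forall y \near x^'+, (y <= c) = (x <= c).
  rewrite neq_lt => /orP[xc|cx].
    by apply: filterS (nbhs_right_lt xc) => y yc; rewrite !ltW.
  apply: filterS (nbhs_right_gt x) => y xy.
  by rewrite !leNgt cx (lt_trans cx xy).
move=> xLB xt; near=> y; rewrite /censored_ecdf.
have -> : (y <= LB) = (x <= LB) by near: y; exact: side.
have -> : (y <= theta) = (x <= theta) by near: y; exact: side.
have -> : ecdf xb y = ecdf xb x by near: y; exact: ecdf_near_right.
have -> : ecdf xe y = ecdf xe x by near: y; exact: ecdf_near_right.
by have -> : ecdf xd y = ecdf xd x by near: y; exact: ecdf_near_right.
Unshelve. all: by end_near. Qed.

(** The last three hypotheses make the margins squared in the exponents nonnegative: squaring hides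
    their sign, and DKW is applied at nonnegative levels. *)
Theorem theorem3 (R : realType) (d : measure_display) (T : measurableType d)
    (P : probability T R) (F : cumulativeBounded (0 : R) (1 : R))
    (LB theta eps eta : R) (n l m ke kd : nat)
    (Xb : 'I_l -> {RV P >-> R})
    (Xe : 'I_(m - l + ke) -> {RV P >-> R})
    (Xd : 'I_(n - m + kd) -> {RV P >-> R}) :
  let beta := F LB in
  let alpha := F theta in
  let lfrac := l%:R / n%:R : R in
  let mfrac := (n - l)%N%:R / n%:R *
    ((m - l + ke)%N%:R / ((n - l + ke)%N%:R + eps * kd%:R)) in
  let dfrac := (n - l)%N%:R / n%:R *
    (((n - m)%N%:R + eps * kd%:R) / ((n - l + ke)%N%:R + eps * kd%:R)) in
  LB < theta ->
  0 < beta -> beta < alpha -> alpha < 1 ->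
  (0 < l)%N -> (l < n)%N -> (l <= m)%N -> (m <= n)%N ->
  0 <= eps -> eps <= 1 ->
  (0 < ke)%N -> (0 < kd)%N -> 0 < eta ->
  iid_with_cdf Xb (cdf_below F LB) ->
  iid_with_cdf Xe (cdf_between F LB theta) ->
  iid_with_cdf Xd (cdf_above F theta) ->
  `|beta - lfrac| <= eta ->
  `|beta - lfrac| + `|alpha - beta - mfrac| <= eta ->
  2 * `|alpha - lfrac - mfrac| <= eta ->
  (P [set w | (eta <= sup [set
        `|F x - censored_ecdf LB theta eps
                  (fun i => Xb i w) (fun i => Xe i w) (fun i => Xd i w) x|
        | x in [set: R]])%R]
   <= (2 * expR (- 2 * l%:R * (eta - `|beta - lfrac|) ^+ 2
                 / Num.min beta lfrac ^+ 2)
       + 2 * expR (- 2 * (m - l + ke)%N%:R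
                   * (eta - `|beta - lfrac| - `|alpha - beta - mfrac|) ^+ 2
                   / Num.min (alpha - beta) mfrac ^+ 2)
       + 2 * expR (- 2 * (n - m + kd)%N%:R
                   * (eta - 2 * `|alpha - lfrac - mfrac|) ^+ 2
                   / Num.min (1 - alpha) dfrac ^+ 2))%R%:E)%E.
Proof.
move=> beta alpha lfrac mfrac dfrac LBtheta beta0 ab alpha1 l0 ln lm mn eps0 eps1
  ke0 kd0 eta0 iidb iide iidd biasb biase biasd.
have e0 : (0 < m - l + ke)%N by rewrite addn_gt0 ke0 orbT.
have d0 : (0 < n - m + kd)%N by rewrite addn_gt0 kd0 orbT.
have Hb y := iid_cdf_itv y l0 iidb.
have He y := iid_cdf_itv y e0 iide.
have Hd y := iid_cdf_itv y d0 iidd.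
have N0 : 0 <= (n - l + ke)%N%:R + eps * kd%:R :> R by rewrite addr_ge0 ?mulr_ge0.
have lfrac0 : 0 <= lfrac by rewrite divr_ge0.
have mfrac0 : 0 <= mfrac by rewrite mulr_ge0 ?divr_ge0.
have dfrac0 : 0 <= dfrac by rewrite mulr_ge0 ?divr_ge0 ?addr_ge0 ?mulr_ge0.
have minb : 0 <= Num.min beta lfrac by rewrite le_min lfrac0 ltW.
have mine : 0 <= Num.min (alpha - beta) mfrac by rewrite le_min mfrac0 subr_ge0 ltW.
have mind : 0 <= Num.min (1 - alpha) dfrac by rewrite le_min dfrac0 subr_ge0 ltW.
pose g x w := `|F x - censored_ecdf LB theta eps
  (fun i => Xb i w) (fun i => Xe i w) (fun i => Xd i w) x|.
have err x w := @censored_ecdf_error R F LB theta eps n l m ke kd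
  (fun i => Xb i w) (fun i => Xe i w) (fun i => Xd i w) x
  LBtheta beta0 ab alpha1 ln lm mn eps0 Hb He Hd.
have mE : measurable [set w | eta <= sup [set g x w | x in [set: R]]].
  (* At [LB] and [theta] the estimate need not be right continuous. *)
  pose D i := if i is i'.+1 then if i' is i''.+1 then rat_seq R i'' else LB else theta.
  apply: (@measurable_le_sup _ _ _ g D).
  - move=> x; apply: measurableT_comp => //; apply: measurable_funB => //.
    rewrite /censored_ecdf; case: (x <= LB); last case: (x <= theta).
    + by apply: measurable_funM => //; exact: measurable_ecdf.
    + by apply: measurable_funD => //; apply: measurable_funM => //; exact: measurable_ecdf.
    + by apply: measurable_funD => //; apply: measurable_funM => //; exact: measurable_ecdf.
  (* Each distance between CDFs is at most 1, so the sum of the three regional bounds serves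
     everywhere. *)
  - move=> w; pose M := (`|beta - lfrac| + Num.min beta lfrac) +
      (`|beta - lfrac| + `|alpha - beta - mfrac| + Num.min (alpha - beta) mfrac) +
      (2 * `|alpha - lfrac - mfrac| + Num.min (1 - alpha) dfrac).
    exists M => x.
    have dist1 (k : nat) (H : R -> R) (s : 'I_k -> R) : (forall y, 0 <= H y <= 1) ->
        `|H x - ecdf s x| <= 1.
      move=> /(_ x) /andP[h0 h1]; have /andP[s0 s1] := ecdf_itv s x.
      by rewrite ler_norml; lra.
    have Mb := ler_piMr minb (dist1 _ _ (fun i => Xb i w) Hb).
    have Me := ler_piMr mine (dist1 _ _ (fun i => Xe i w) He).
    have Md := ler_piMr mind (dist1 _ _ (fun i => Xd i w) Hd).
    have nb := normr_ge0 (beta - lfrac).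
    have ne := normr_ge0 (alpha - beta - mfrac).
    have nd := normr_ge0 (alpha - lfrac - mfrac).
    rewrite /M; case: (err x w) => h; apply: (le_trans h);
      clear -Mb Me Md nb ne nd minb mine mind; lra.
  - move=> w s x sg.
    have [xLB|xLB] := eqVneq x LB; first by exists 1%N; rewrite /= -xLB.
    have [xt|xt] := eqVneq x theta; first by exists 0%N; rewrite /= -xt.
    have [|i si] := @right_continuous_lt_rat_seq R (g^~ w) s x _ sg; last by exists i.+2.
    apply: cvg_norm; apply: cvgB; first exact: cumulative_is_right_continuous.
    exact: cvg_near_cst (censored_ecdf_near_right _ _ _ _ xLB xt).
have [Bb [mBb PBb Bbs]] := weighted_dkw l0 iidb biasb minb.
have [Be [mBe PBe Bes]] := weighted_dkw e0 iide biase mine.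
have [Bd [mBd PBd Bds]] := weighted_dkw d0 iidd biasd mind.
apply: (@le_trans _ _ (P (Bb `|` Be `|` Bd))).
  apply: le_measure; rewrite ?inE; [exact: mE|by apply: measurableU => //; exact: measurableU|].
  (* Outside the three covering sets the error stays below the largest of three levels, all strictly
     less than [eta]; this uniform gap keeps the supremum below [eta]. *)
  move=> w /=; apply: contraPP =>
    /not_orP[/not_orP[/Bbs[sb sbe hb] /Bes[se see he]] /Bds[sd sde hd]].
  apply/negP; rewrite -ltNge; apply: (@le_lt_trans _ _ (Num.max sb (Num.max se sd))).
    apply: ge_sup; first by exists (g 0 w), 0.
    move=> _ [x _ <-]; rewrite !le_max; case: (err x w) => h.
    - by rewrite (le_trans h (hb x)).
    - by rewrite (le_trans h (he x)) orbT.
    - by rewrite (le_trans h (hd x)) !orbT.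
  by rewrite !gt_max sbe see.
apply: (le_trans (measureU2 _ _ _)) => //; first exact: measurableU.
rewrite [leRHS]EFinD; apply: leeD.
  apply: (le_trans (measureU2 _ _ _)) => //.
  by rewrite EFinD; apply: leeD => //; rewrite -addrA -opprD.
exact: PBd.
Qed.
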